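(* Let $N\geq 1$ and $\sigma>0$. The normalising factor $Z(\sigma)$ of Gaussian distributions on the space $\mathrm{H}(N)$ of $N\times N$ Hermitian positive-definite matrices, given by $$Z(\sigma)=\frac{\omega_2(N)}{2^{N^2}N!}\,\exp\left[-\frac{N^3}{2}\sigma^2\right]\int_{\mathbb{R}_+^N}\prod_{i=1}^N\rho(u_i,2\sigma^2)\,|V(u)|^2\,\prod_{i=1}^N du_i ,$$ admits the following analytic formula $$Z(\sigma)=\frac{\omega_2(N)}{2^{N^2}}\left(2\pi\sigma^2\right)^{\frac N2}\exp\left[\left(\frac{N^3-N}{6}\right)\sigma^2\right]\prod_{n=1}^{N-1}\left(1-e^{-n\sigma^2}\right)^{N-n}.$$
   Context: $\rho(u,k)=\exp(-\log^2(u)/k)$ for $u>0$, and $V(u)=\prod_{i<j}(u_j-u_i)$ is the Vandermonde determinant. The constant $\omega_2(N)$ is the invariant volume of $U(N)/T_N$ ($T_N$ the torus of diagonal unitary matrices), $\omega_2(N)=(2\pi)^{(N^2-N)/2}/G(N)$ with $G(N)=1!\times 2!\times\cdots\times(N-1)!$. The displayed multiple integral is the expression (as derived in the paper from integration formulae on symmetric spaces) of the factor normalising the density profile $\exp[-d^2(x,\bar x)/2\sigma^2]$ on $\mathrm{H}(N)$; for this statement it may be taken as the definition of $Z(\sigma)$. *)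

(* Defs.v *)
From HB Require Import structures.
From mathcomp Require Import all_boot all_order all_algebra.
From mathcomp Require Import all_classical all_reals all_analysis.
Import Order.TTheory GRing.Theory Num.Theory.
Import numFieldNormedType.Exports.

Set Implicit Arguments.
Unset Strict Implicit.
Unset Printing Implicit Defensive.

Local Open Scope classical_set_scope.
Local Open Scope ring_scope.

(* Lebesgue measure on R^n, carried by [n.-tuple R] with its product
   sigma-algebra: the n-fold product of the one-dimensional measure. *)
Section lebesgue_tuple.
Context {R : realType}.
Local Notation T := (measurableTypeR R).

Definition cons_pair n (p : T * n.-tuple T) : n.+1.-tuple T :=
  [tuple of p.1 :: p.2].

Lemma measurable_cons_pair n : measurable_fun [set: T * n.-tuple T] (@cons_pair n).
Proof. exact: measurable_cons. Qed.

Section succ.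
Variables (n : nat) (m : {sigma_finite_measure set (n.-tuple T) -> \bar R}).

Let mu : {sigma_finite_measure set T -> \bar R} := @lebesgue_measure R.

Definition lebesgue_cons : set (n.+1.-tuple T) -> \bar R :=
  pushforward (product_measure1 mu m) (@cons_pair n).

Let mc := @measurable_cons_pair n.

Let lebesgue_cons0 : lebesgue_cons set0 = 0%E.
Proof. exact: measure0. Qed.

Let lebesgue_cons_ge0 A : (0 <= lebesgue_cons A)%E.
Proof. exact: measure_ge0. Qed.

Let lebesgue_cons_sigma_additive : semi_sigma_additive lebesgue_cons.
Proof. exact: measure_semi_sigma_additive. Qed.

HB.instance Definition _ := isMeasure.Build _ _ _ lebesgue_cons
  lebesgue_cons0 lebesgue_cons_ge0 lebesgue_cons_sigma_additive.

Let lebesgue_cons_sigma_finite : sigma_finite setT lebesgue_cons.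
Proof.
have /sigma_finiteP[F [TF ndF Foo]] := sigma_finiteT mu.
have /sigma_finiteP[H [TH ndH Hoo]] := sigma_finiteT m.
pose uncons (t : n.+1.-tuple T) : T * n.-tuple T := (thead t, [tuple of behead t]).
have consK p : uncons (cons_pair p) = p.
  by case: p => x t; congr pair; apply/val_inj.
have muncons : measurable_fun setT uncons.
  apply/measurable_fun_pairP; split; first exact: measurable_tnth.
  exact: measurable_behead.
exists (fun i => uncons @^-1` (F i `*` H i)) => [|i].
  apply/esym; rewrite -subTset => t _.
  have [i _ Fi] : (\bigcup_i F i) (uncons t).1 by rewrite -TF.
  have [j _ Hj] : (\bigcup_i H i) (uncons t).2 by rewrite -TH.
  exists (maxn i j) => //; split.
    by move: Fi; exact/subsetPset/ndF/leq_maxl.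
  by move: Hj; exact/subsetPset/ndH/leq_maxr.
have [mF Fi] := Foo i; have [mH Hi] := Hoo i; split.
  by rewrite -[X in measurable X]setTI; apply: muncons => //; exact: measurableX.
rewrite /lebesgue_cons /pushforward -comp_preimage (_ : _ \o _ = id).
  by rewrite preimage_id product_measure1E// lte_mul_pinfty// ge0_fin_numE.
exact/funext.
Qed.

HB.instance Definition _ := Measure_isSigmaFinite.Build _ _ _ lebesgue_cons
  lebesgue_cons_sigma_finite.

End succ.

Fixpoint lebesgue_tuple n : {sigma_finite_measure set (n.-tuple T) -> \bar R} :=
  if n is n'.+1 then lebesgue_cons (lebesgue_tuple n') else \d_[tuple].

Lemma lebesgue_tuple_box n (A : 'I_n -> set T) :
  (forall i, measurable (A i)) ->
  lebesgue_tuple n [set u | forall i, A i (tnth u i)] =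
  (\prod_(i < n) lebesgue_measure (A i))%E.
Proof.
elim: n A => [|n IHn] A mA.
  by rewrite big_ord0 /= diracE mem_set// => -[].
rewrite big_ord_recl -IHn// -product_measure1E//; last first.
  rewrite (_ : [set _ | _] =
      \bigcap_(i in [set: 'I_n]) ((@tnth n T)^~ i @^-1` A (lift ord0 i))).
    apply: fin_bigcap_measurable => // i _.
    by rewrite -[X in measurable X]setTI; exact: measurable_tnth.
  by apply/seteqP; split => u /= Hu i; [move=> _; exact: Hu|exact: (Hu i I)].
rewrite /= /lebesgue_cons /pushforward; congr (product_measure1 _ _ _).
apply/seteqP; split => -[x t] /= H.
  split; first exact: (H ord0).
  by move=> i; move: (H (lift ord0 i)); rewrite /cons_pair tnthS.
case: H => Hx Ht i; case: (unliftP ord0 i) => [j ->|->//].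
by rewrite /cons_pair tnthS.
Qed.

End lebesgue_tuple.

Section gaussian_normaliser.
Context {R : realType}.
Implicit Types (N : nat) (sigma : R).

Definition rho (u k : R) : R := expR (- (ln u ^+ 2 / k)).

Definition vandermonde N (u : N.-tuple R) : R :=
  \prod_(i < N) \prod_(j < N | (i < j)%N) (tnth u j - tnth u i).

Definition G N : R := \prod_(1 <= k < N) (k`!)%:R.

(* Invariant volume of U(N)/T_N, given by its closed-form value. *)
Definition omega2 N : R := (2 * pi) `^ ((N%:R ^+ 2 - N%:R) / 2) / G N.

Definition Z_integrand N sigma (u : N.-tuple R) : R :=
  (\prod_(i < N) rho (tnth u i) (2 * sigma ^+ 2)) * `|vandermonde u| ^+ 2.

Definition positive_orthant N : set (N.-tuple (measurableTypeR R)) :=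
  [set u | forall i, (0 : R) < tnth u i].
Arguments positive_orthant : clear implicits.

(* Extended-real valued, so that the closed formula also asserts that the
   integral converges. *)
Definition Z N sigma : \bar R :=
  ((omega2 N / (2 ^+ (N ^ 2)%N * (N`!)%:R)
      * expR (- (N%:R ^+ 3 / 2 * sigma ^+ 2)))%:E
   * \int[lebesgue_tuple N]_(u in positive_orthant N)
       (Z_integrand sigma u)%:E)%E.

End gaussian_normaliser.

(* Main.v *)
(* Writing V = det (u_i ^ j) as a sum over permutations and integrating term by
   term (Tonelli) turns the multiple integral into N! times the Hankel
   determinant of the moments of rho on the half-line.  The substitution
   x = exp y and completing the square give
     m_k = sqrt (2 pi sigma^2) exp ((k + 1)^2 sigma^2 / 2),
   and (i + j + 1)^2 / 2 = (i + 1)^2 / 2 + (j^2 / 2 + j) + i j exhibits the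
   Hankel matrix as a Vandermonde matrix at the nodes exp (i sigma^2), up to row
   and column factors. *)
Require Import Defs.
From mathcomp Require Import all_boot all_order all_algebra.
From mathcomp Require Import all_classical all_reals all_analysis.
From mathcomp Require Import measurable_realfun normal_distribution perm ring.
Import Order.TTheory GRing.Theory Num.Theory.
Import numFieldNormedType.Exports.
Local Open Scope classical_set_scope.
Local Open Scope ring_scope.

(** * Moments of the weight on the half-line *)

Lemma ge0_integration_by_substitution_expR (R : realType) (G : R -> R) :
  (forall x, 0 < x -> {for x, continuous G}) ->
  (forall x, 0 < x -> 0 <= G x) ->
  (\int[lebesgue_measure]_(x in `]0%R, +oo[) (G x)%:E =
   \int[lebesgue_measure]_x (G (expR x) * expR x)%:E)%E.
(* The library's whole-line substitution rule requires the derivative to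
   converge at both infinities, which fails for expR; hence the exhaustion by
   the intervals [-n, n] and their images. *)
Proof.
move=> cG G0.
have DexpR : derive1 expR = @expR R.
  by apply/funext => x; rewrite derive1E derive_val.
have cexpR : continuous (@expR R) by exact: continuous_expR.
pose E (n : nat) : set R := `[expR (- n%:R), expR n%:R]%classic.
pose F (n : nat) : set R := `[- n%:R, n%:R]%classic.
have EE : \bigcup_n E n = `]0, +oo[%classic.
  apply/seteqP; split => [x [n _]|x]; rewrite /E /= !in_itv/= ?andbT.
    by move=> /andP[+ _]; apply: lt_le_trans; exact: expR_gt0.
  move=> x0; exists (Num.truncn `|ln x|).+1 => //=.
  rewrite /E/= in_itv/= -[x in _ <= x <= _]lnK// !ler_expR -ler_norml.
  exact/ltW/truncnS_gt.
have FE : \bigcup_n F n = setT.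
  apply/seteqP; split => // x _; exists (Num.truncn `|x|).+1 => //=.
  by rewrite /F/= in_itv/= -ler_norml; exact/ltW/truncnS_gt.
have cvgE : (\int[lebesgue_measure]_(x in E n) (G x)%:E @[n --> \oo] -->
             \int[lebesgue_measure]_(x in `]0%R, +oo[) (G x)%:E)%E.
  rewrite -EE; apply: ge0_nondecreasing_set_cvg_integral.
  - move=> n m nm; apply/subsetPset => x; rewrite /E/= !in_itv/= => /andP[a b].
    by rewrite (le_trans _ a) ?(le_trans b)// ler_expR ?lerN2 ler_nat.
  - by move=> n; exact: measurable_itv.
  - move=> n; apply/measurable_EFinP; apply: subspace_continuous_measurable_fun.
      exact: measurable_itv.
    apply: continuous_in_subspaceT => x; rewrite inE /E/= in_itv/= => /andP[a _].
    by apply: cG; apply: lt_le_trans a; exact: expR_gt0.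
  - move=> n x; rewrite /E/= in_itv/= => /andP[a _]; rewrite lee_fin G0//.
    by apply: lt_le_trans a; exact: expR_gt0.
have cH x : {for x, continuous (fun y => G (expR y) * expR y)}.
  apply: cvgM; last exact: cexpR.
  apply: (@continuous_comp _ _ _ expR G x); first exact: cexpR.
  by apply: cG; exact: expR_gt0.
have cvgF : (\int[lebesgue_measure]_(x in F n) (G (expR x) * expR x)%:E
    @[n --> \oo] --> \int[lebesgue_measure]_x (G (expR x) * expR x)%:E)%E.
  rewrite -[X in (integral _ X)]FE; apply: ge0_nondecreasing_set_cvg_integral.
  - move=> n m nm; apply/subsetPset => x; rewrite /F/= !in_itv/= => /andP[a b].
    by rewrite (le_trans _ a) ?(le_trans b)// ?lerN2 ler_nat.
  - by move=> n; exact: measurable_itv.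
  - move=> n; apply/measurable_EFinP; apply: subspace_continuous_measurable_fun.
      exact: measurable_itv.
    by apply: continuous_in_subspaceT => x _; exact: cH.
  - by move=> n x _; rewrite lee_fin mulr_ge0 ?expR_ge0// G0// expR_gt0.
(* On each compact interval the classical substitution rule applies, so both sequences agree
   termwise and share their limit. *)
apply: (cvg_unique _ cvgE) => //.
rewrite (_ : (fun n => _) =
  (fun n => \int[lebesgue_measure]_(x in F n) (G (expR x) * expR x)%:E)%E) //.
apply/funext => n; rewrite /E /F integration_by_substitution_increasing//.
- by rewrite DexpR.
- by rewrite (le_trans (y := 0))// oppr_le0.
- by move=> x y _ _; rewrite ltr_expR.
- by rewrite DexpR => x _; exact: cexpR.
- by rewrite DexpR; apply/cvg_ex; eexists; apply: cvg_at_right_filter; exact: cexpR.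
- by rewrite DexpR; apply/cvg_ex; eexists; apply: cvg_at_left_filter; exact: cexpR.
- split.
  + by move=> x _; exact: derivable_expR.
  + by apply: cvg_at_right_filter; exact: cexpR.
  + by apply: cvg_at_left_filter; exact: cexpR.
- apply: continuous_in_subspaceT => x; rewrite inE/= in_itv/= => /andP[a _].
  by apply: cG; apply: lt_le_trans a; exact: expR_gt0.
Qed.

(** After x = exp y the integrand is a constant multiple of the normal density with mean (k + 1)
    sigma^2 and variance sigma^2. The shift from k to k + 1 comes from dx = exp y dy. *)
Lemma integral_lognormal_moment (R : realType) (sigma : R) (k : nat) :
  0 < sigma ->
  (\int[lebesgue_measure]_(x in `]0%R, +oo[)
      (rho x (2 * sigma ^+ 2) * x ^+ k)%:E =
   (Num.sqrt (2 * pi * sigma ^+ 2)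
      * expR (k.+1%:R ^+ 2 / 2 * sigma ^+ 2))%:E)%E.
Proof.
move=> s0; have sn0 : sigma != 0 by rewrite gt_eqF.
have p0 := normal_peak_gt0 sn0.
rewrite (@ge0_integration_by_substitution_expR R
  (fun x => rho x (2 * sigma ^+ 2) * x ^+ k)); last 2 first.
- move=> x x0; rewrite /rho; apply: cvgM; last exact: exprn_continuous.
  apply: continuous_comp; last exact: continuous_expR.
  apply: cvgN; apply: cvgMl.
  apply: (@continuous_comp _ _ _ (@ln R) (fun y => y ^+ 2)).
    exact: continuous_ln.
  exact: exprn_continuous.
- by move=> x x0; rewrite mulr_ge0 ?expR_ge0// exprn_ge0// ltW.
set C := (X in _ = X%:E).
transitivity (\int[lebesgue_measure]_x (C%:E *
    (normal_pdf (k.+1%:R * sigma ^+ 2) sigma x)%:E))%E; last first.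
  rewrite integralZl ?integral_normal_pdf ?mule1//.
  exact: integrable_normal_pdf.
apply: eq_integral => x _; congr (_%:E).
rewrite normal_pdfE// /C /normal_peak /normal_fun.
rewrite (_ : sigma ^+ 2 * pi *+ 2 = 2 * pi * sigma ^+ 2); last by ring.
(* The square root in [C] cancels the peak of the density; what remains is the completed square. *)
rewrite -[RHS]/(_ * (_ * _)) mulrACA divff ?mul1r; last first.
  by rewrite gt_eqF// sqrtr_gt0 !mulr_gt0 ?pi_gt0// exprn_gt0.
rewrite /rho expRK -expRM_natl -!expRD; congr expR.
by field.
Qed.

(** * From the multiple integral to a Hankel determinant *)

Lemma tnth_cons_pair (R : realType) n (x : R) (t : n.-tuple R) (i : 'I_n) :
  tnth (cons_pair (x, t)) (lift ord0 i) = tnth t i.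
Proof. by rewrite /cons_pair tnthS. Qed.

(** Induction on [n]: Tonelli splits off the first coordinate. Nonnegativity replaces integrability,
    so the identity can later be used to prove integrability. *)
Lemma integral_lebesgue_tuple_prod (R : realType) n (f : 'I_n -> R -> R) :
  (forall i, measurable_fun [set: measurableTypeR R] (f i)) ->
  (forall i x, 0 <= f i x) ->
  (\int[lebesgue_tuple n]_u (\prod_(i < n) f i (tnth u i))%:E =
   \prod_(i < n) \int[@lebesgue_measure R]_x (f i x)%:E)%E.
Proof.
have mprod k (g : 'I_k -> R -> R) :
    (forall i, measurable_fun [set: measurableTypeR R] (g i)) ->
    measurable_fun [set: k.-tuple (measurableTypeR R)]
      (fun u => (\prod_(i < k) g i (tnth u i))%:E).
  move=> mg; apply/measurable_EFinP; apply: measurable_prod => i _.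
  exact: (measurableT_comp (mg i) (measurable_tnth i)).
elim: n f => [|n IHn] f mf f0.
  rewrite big_ord0 /= integral_dirac//; last exact: mprod.
  by rewrite big_ord0 mule1 diracT.
rewrite /= /lebesgue_cons ge0_integral_pushforward//=; last 3 first.
- exact: measurable_cons_pair.
- exact: mprod.
- by move=> u _; rewrite lee_fin prodr_ge0.
rewrite preimage_setT fubini_tonelli1//=; last 2 first.
- exact: (measurableT_comp (mprod _ _ mf) (@measurable_cons_pair R n)).
- by move=> u; rewrite lee_fin prodr_ge0.
rewrite big_ord_recl -IHn//.
rewrite /fubini_F -ge0_integralZr//; last 3 first.
- by apply/measurable_EFinP; exact: mf.
- by move=> x _; rewrite lee_fin.
- by apply: integral_ge0 => u _; rewrite lee_fin prodr_ge0.
apply: eq_integral => x _.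
rewrite -ge0_integralZl//; last 3 first.
- exact: (mprod _ (fun i => f (lift ord0 i))).
- by move=> u _; rewrite lee_fin prodr_ge0.
- by rewrite lee_fin.
apply: eq_integral => u _; rewrite -EFinM big_ord_recl; congr (_ * _)%:E.
by apply: eq_bigr => i _; rewrite tnth_cons_pair.
Qed.

Lemma vandermonde_det (R : realType) N (u : N.-tuple R) :
  vandermonde u =
  \sum_(s : 'S_N) (-1) ^+ s * \prod_(i < N) tnth u i ^+ s i.
Proof.
have := det_Vandermonde (\row_i tnth u i).
(* Transposing makes the rows carry the variables, so that permutations act on the exponents. *)
rewrite -det_tr /determinant => E.
transitivity (\prod_(i < N) \prod_(j < N | (i < j)%N)
    ((\row_i tnth u i) 0 j - (\row_i tnth u i) 0 i)).
  by apply: eq_bigr => i _; apply: eq_bigr => j _; rewrite !mxE.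
rewrite -E; apply: eq_bigr => s _; congr (_ * _).
by apply: eq_bigr => i _; rewrite !mxE.
Qed.

(** For fixed [s], replacing [t] by [s * t] cancels the sign of [s], and reindexing the product by
    [s] leaves the Leibniz sum; each of the N! choices of [s] thus contributes one determinant. *)
Lemma sum_perm_perm_det (R : comNzRingType) N (m : 'I_N -> 'I_N -> R) :
  \sum_(s : 'S_N) \sum_(t : 'S_N)
     (-1) ^+ s * (-1) ^+ t * \prod_(i < N) m (s i) (t i) =
  N`!%:R * \det (\matrix_(i, j) m i j).
Proof.
transitivity (\sum_(s : 'S_N) \det (\matrix_(i, j) m i j)); last first.
  by rewrite sumr_const card_Sn mulr_natl.
apply: eq_bigr => s _; rewrite /determinant.
rewrite (reindex_inj (mulgI s)) /=; apply: eq_bigr => t _.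
rewrite odd_permM signr_addb mulrA -expr2 sqrr_sign mul1r; congr (_ * _).
rewrite [RHS](reindex_inj (@perm_inj _ s)) /=.
by apply: eq_bigr => i _; rewrite !mxE permM.
Qed.

(** Heine's identity. The expanded square has signed terms, so each is first integrated without its
    sign: as [w] vanishes on the negative axis, it is a product of nonnegative factors. The finite
    values give integrability, and linearity restores the signs. *)
Lemma integral_weight_vandermonde2 (R : realType) N (w : R -> R) (m : nat -> R) :
  measurable_fun [set: measurableTypeR R] w ->
  (forall x, 0 <= w x) -> (forall x, x < 0 -> w x = 0) ->
  (forall k, \int[lebesgue_measure]_x (w x * x ^+ k)%:E = (m k)%:E)%E ->
  (\int[lebesgue_tuple N]_u
     ((\prod_(i < N) w (tnth u i)) * vandermonde u ^+ 2)%:E =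
   (N`!%:R * \det (\matrix_(i < N, j < N) m (i + j)%N))%:E)%E.
Proof.
move=> mw w0 wneg mE.
pose f (s t : 'S_N) (u : N.-tuple R) :=
  \prod_(i < N) (w (tnth u i) * tnth u i ^+ (s i + t i)%N).
have f0 k x : 0 <= w x * x ^+ k.
  have [x0|/wneg->] := leP 0 x; last by rewrite mul0r.
  by rewrite mulr_ge0// exprn_ge0.
have mwX k : measurable_fun [set: measurableTypeR R] (fun x => w x * x ^+ k).
  by apply: measurable_funM => //; exact: measurable_funX.
have intf s t : (\int[lebesgue_tuple N]_u (f s t u)%:E =
    (\prod_(i < N) m (s i + t i)%N)%:E)%E.
  rewrite (@integral_lebesgue_tuple_prod R N
    (fun i x => w x * x ^+ (s i + t i)%N))//.
  by rewrite -prodEFin; apply: eq_bigr.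
have If s t : (lebesgue_tuple N).-integrable setT (EFin \o f s t).
  apply/integrableP; split.
    apply/measurable_EFinP; apply: measurable_prod => i _.
    exact: (measurableT_comp (mwX _) (measurable_tnth i)).
  under eq_integral => u _.
    rewrite gee0_abs ?lee_fin ?prodr_ge0//; over.
  by rewrite intf ltry.
rewrite -sum_perm_perm_det.
transitivity (\int[lebesgue_tuple N]_u (\sum_(p : 'S_N * 'S_N)
    ((-1) ^+ p.1 * (-1) ^+ p.2)%:E * (f p.1 p.2 u)%:E))%E.
  apply: eq_integral => u _; rewrite vandermonde_det expr2 mulr_suml mulr_sumr.
  under eq_bigr do rewrite !mulr_sumr.
  rewrite pair_bigA /= -sumEFin; apply: eq_bigr => p _.
  rewrite -EFinM; congr _%:E; 
  transitivity ((-1) ^+ p.1 * (-1) ^+ p.2 * ((\prod_i w (tnth u i)) *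
    ((\prod_i tnth u i ^+ p.1 i) * \prod_i tnth u i ^+ p.2 i)));
    first by move: (_ ^+ p.1) (_ ^+ p.2) (bigop _ _ _) (bigop _ _ _) (bigop _ _ _)
      => *; ring.
  congr (_ * _).
  rewrite /f -!big_split; apply: eq_bigr => i _ /=.
  by rewrite exprD.
rewrite integral_sum//; last first.
  by move=> p; apply: integrableZl => //; exact: If.
rewrite pair_bigA /= -sumEFin; apply: eq_bigr => p _.
by rewrite integralZl ?intf//; exact: If.
Qed.

(** * Evaluation of the Hankel determinant *)

Lemma prod_lt_ord_recr (R : comNzRingType) N (F : nat -> nat -> R) :
  \prod_(i < N.+1) \prod_(j < N.+1 | (i < j)%N) F i j =
  (\prod_(i < N) \prod_(j < N | (i < j)%N) F i j) * \prod_(i < N) F i N.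
Proof.
rewrite big_ord_recr /= [X in _ * X]big_pred0 ?mulr1; last first.
  by move=> j; rewrite ltnNge -ltnS ltn_ord.
rewrite -big_split; apply: eq_bigr => i _ /=.
by rewrite big_mkcond big_ord_recr /= ltn_ord -big_mkcond.
Qed.

(** The difference n occurs for N - n pairs. In the induction, a new largest index N adds each
    difference from 1 to N once. *)
Lemma prod_lt_ord_diff (R : comNzRingType) N (g : nat -> R) :
  \prod_(i < N) \prod_(j < N | (i < j)%N) g (j - i)%N =
  \prod_(1 <= n < N) g n ^+ (N - n).
Proof.
elim: N => [|N IHN]; first by rewrite big_ord0 big_geq.
rewrite (@prod_lt_ord_recr R N (fun i j => g (j - i)%N)) IHN.
case: N {IHN} => [|N]; first by rewrite !big_ord0 !big_geq// mulr1.
transitivity (\prod_(1 <= n < N.+2) (g n ^+ (N.+1 - n) * g n)); last first.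
  by apply: eq_big_nat => n /andP[_ nN]; rewrite -exprSr -subSn.
(* The top factor has exponent 0 in the first product, so it drops out there. *)
rewrite big_split /= [in RHS]big_nat_recr//= subnn mulr1; congr (_ * _).
rewrite big_add1 big_mkord (reindex_inj rev_ord_inj) /=.
by apply: eq_bigr => i _; rewrite subKn.
Qed.

Lemma det_matrix_scale (R : comNzRingType) N (a b : 'I_N -> R) (M : 'M[R]_N) :
  \det (\matrix_(i, j) (a i * M i j * b j)) =
  (\prod_i a i) * \det M * \prod_i b i.
Proof.
rewrite (_ : \matrix_(i, j) _ =
    diag_mx (\row_i a i) *m M *m diag_mx (\row_i b i)); last first.
  by apply/matrixP => i j; rewrite mul_mx_diag mul_diag_mx !mxE.
rewrite !det_mulmx !det_diag; congr (_ * _ * _);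
  by apply: eq_bigr => i _; rewrite mxE.
Qed.

Lemma det_gaussian_hankel (R : realType) N (c s : R) :
  \det (\matrix_(i < N, j < N) (c * expR ((i + j)%N.+1%:R ^+ 2 / 2 * s))) =
  c ^+ N * expR ((2 / 3 * N%:R ^+ 3 - N%:R / 6) * s) *
  \prod_(1 <= n < N) (1 - expR (- (n%:R * s))) ^+ (N - n).
Proof.
pose a (i : nat) := c * expR (i.+1%:R ^+ 2 / 2 * s).
pose b (j : nat) := expR ((j%:R ^+ 2 / 2 + j%:R) * s).
pose q (i : nat) := expR (i%:R * s).
rewrite (_ : \matrix_(i, j) _ = \matrix_(i < N, j < N)
   (a i * (Vandermonde N (\row_(i < N) q i))^T i j * b j)); last first.
  apply/matrixP => i j; rewrite !mxE /a /b /q -expRM_natl -!mulrA -!expRD.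
  by congr (_ * expR _); rewrite -!natr1 natrD; field.
rewrite (@det_matrix_scale R N (fun i => a i) (fun j => b j)) det_tr.
rewrite det_Vandermonde.
under [X in _ * X * _]eq_bigr do under eq_bigr do rewrite !mxE.
(* Both sides now contain a product over pairs i < j, so induction on [N] can compare the factors
   gained from the last index. *)
rewrite -prod_lt_ord_diff.
elim: N => [|N IHN].
  by rewrite !big_ord0 expr0 expr0n /= mulr0 mul0r subr0 mul0r expR0 !mulr1.
rewrite (@prod_lt_ord_recr R N (fun i j => q j - q i)).
rewrite (@prod_lt_ord_recr R N (fun i j => 1 - expR (- ((j - i)%:R * s)))).
rewrite ![\prod_(i < N.+1) _]big_ord_recr /=.
(* Factoring [q N] out of each difference leaves 1 - exp (- (N - i) s); the N copies of [q N] give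
   exp (N^2 s). *)
have -> : \prod_(i < N) (q N - q i) =
    expR (N%:R ^+ 2 * s) * \prod_(i < N) (1 - expR (- ((N - i)%:R * s))).
  rewrite (_ : expR _ = \prod_(i < N) q N); last first.
    by rewrite prodr_const card_ord -expRM_natl; congr expR; ring.
  rewrite -big_split; apply: eq_bigr => i _ /=.
  rewrite mulrBr mulr1 /q -expRD natrB ?(ltnW (ltn_ord i))//; congr (_ - expR _).
  by ring.
set A := \prod_(i < N) a i in IHN *; set B := \prod_(i < N) b i in IHN *.
set V := (X in _ * X * _ = _) in IHN; set P := (X in _ = _ * X) in IHN.
set Q := \prod_(i < N) (1 - _).
transitivity ((A * V * B) * Q * (a N * b N * expR (N%:R ^+ 2 * s))).
  by rewrite -/V; ring.
rewrite IHN -/P /a /b.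
transitivity (c ^+ N * P * Q * c * (expR ((2 / 3 * N%:R ^+ 3 - N%:R / 6) * s) *
  expR (N.+1%:R ^+ 2 / 2 * s) * expR ((N%:R ^+ 2 / 2 + N%:R) * s) *
  expR (N%:R ^+ 2 * s))); first by ring.
rewrite -!expRD.
(* The cubic grows by 2 N^2 + 2 N + 1/2, which is the sum of the exponents from [a N], [b N] and the
   N copies of [q N]. *)
rewrite (_ : (2 / 3 * N.+1%:R ^+ 3 - N.+1%:R / 6) * s =
  (2 / 3 * N%:R ^+ 3 - N%:R / 6) * s + N.+1%:R ^+ 2 / 2 * s +
  (N%:R ^+ 2 / 2 + N%:R) * s + N%:R ^+ 2 * s); last by rewrite -natr1; field.
by rewrite [c ^+ N.+1]exprSr; ring.
Qed.

(** * Assembly of the closed formula *)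

Lemma integral_Z_integrand (R : realType) N (sigma : R) : 0 < sigma ->
  (\int[lebesgue_tuple N]_(u in @positive_orthant R N) (Z_integrand sigma u)%:E =
   (N`!%:R * (Num.sqrt (2 * pi * sigma ^+ 2) ^+ N
      * expR ((2 / 3 * N%:R ^+ 3 - N%:R / 6) * sigma ^+ 2)
      * \prod_(1 <= n < N) (1 - expR (- (n%:R * sigma ^+ 2))) ^+ (N - n)))%:E)%E.
Proof.
move=> s0.
(* Cutting [rho] off at 0 moves the orthant into the weight: outside it, some coordinate makes the
   product of weights vanish. *)
pose w (x : R) := if 0 < x then rho x (2 * sigma ^+ 2) else 0.
rewrite -det_gaussian_hankel.
rewrite -(@integral_weight_vandermonde2 R N w
  (fun k => Num.sqrt (2 * pi * sigma ^+ 2) * expR (k.+1%:R ^+ 2 / 2 * sigma ^+ 2))).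
- rewrite integral_mkcond; apply: eq_integral => u _; rewrite patchE.
  case: ifPn => [|/negP]; rewrite inE => up.
    rewrite /Z_integrand real_normK ?num_real//; congr (_ * _)%:E.
    by apply: eq_bigr => i _; rewrite /w up.
  have /existsP[i ui] : [exists i, ~~ (0 < tnth u i)].
    by rewrite -negb_forall; apply/negP => /forallP.
  by rewrite (bigD1 i)//= /w (negbTE ui) !mul0r.
- apply: measurable_fun_ifT => //.
    exact: measurable_fun_ltr.
  rewrite /rho; apply: measurableT_comp => //; apply: measurableT_comp => //.
  by apply: measurable_funM => //; apply: measurable_funX; exact: measurable_ln.
- by move=> x; rewrite /w; case: ifP => // _; exact: expR_ge0.
- by move=> x x0; rewrite /w ltNge ltW.
- move=> k; rewrite -integral_lognormal_moment// [RHS]integral_mkcond.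
  apply: eq_integral => x _; rewrite patchE /w mem_setE in_itv/= andbT.
  by case: ifP => // _; rewrite mul0r.
Qed.

Theorem proposition3p8 (R : realType) (N : nat) (sigma : R) :
  (1 <= N)%N -> 0 < sigma ->
  Z N sigma =
  (omega2 N / 2 ^+ (N ^ 2)%N
     * (2 * pi * sigma ^+ 2) `^ (N%:R / 2)
     * expR ((N%:R ^+ 3 - N%:R) / 6 * sigma ^+ 2)
     * \prod_(1 <= n < N) (1 - expR (- (n%:R * sigma ^+ 2))) ^+ (N - n)%N)%:E.
Proof.
move=> _ s0; rewrite /Z integral_Z_integrand// -EFinM; congr _%:E.
have c0 : 0 <= 2 * pi * sigma ^+ 2 by rewrite mulr_ge0 ?sqr_ge0// mulr_ge0// pi_ge0.
rewrite [N%:R / 2]mulrC powRrM powR12_sqrt// powR_mulrn ?sqrtr_ge0//.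
set c := Num.sqrt _; set P := \prod_(1 <= n < N) _.
(* The prefactor of [Z] contributes -1/2 and the determinant 2/3 to the coefficient of N^3, leaving
   1/6. *)
have -> : (N%:R ^+ 3 - N%:R) / 6 * sigma ^+ 2 = - (N%:R ^+ 3 / 2 * sigma ^+ 2)
    + (2 / 3 * N%:R ^+ 3 - N%:R / 6) * sigma ^+ 2 by field.
rewrite expRD.
have f0 : N`!%:R != 0 :> R by rewrite pnatr_eq0 -lt0n fact_gt0.
move: (expR _) (expR _) (omega2 N) => e1 e2 om.
by field; rewrite f0 expf_neq0.
Qed.
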